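(* There is a constant $k$ such that for every (claw, $4K_1$, bridge, $C_4$-twin)-free graph $G$, one of the following holds: (i) $G$ is perfect; (ii) $G$ has clique-width at most $k$.
   Context: All graphs are finite, simple and undirected. For a set $L$ of graphs, a graph $G$ is $L$-free if $G$ contains no graph of $L$ as an induced subgraph. The claw is $K_{1,3}$. $4K_1$ is the stable set on four vertices. The bridge is the six-vertex graph obtained from two disjoint copies of $K_4$ by identifying an edge of one with an edge of the other: its vertices are $u,v,a,b,c,d$, the sets $\{u,v,a,b\}$ and $\{u,v,c,d\}$ are cliques, and there are no edges between $\{a,b\}$ and $\{c,d\}$. The $C_4$-twin is the five-vertex graph on $\{1,2,3,4,5\}$ with edges $12,13,42,43,25,35,14$ (a chordless 4-cycle with one vertex duplicated by an adjacent twin). A graph $G$ is perfect if $\chi(H)=\omega(H)$ for every induced subgraph $H$ of $G$, where $\chi$ is the chromatic number and $\omega$ the number of vertices of a largest clique. The clique-width of a graph is the smallest number of labels needed to construct it using the operations: create a new vertex with label $i$; take the disjoint union of two labelled graphs; relabel all vertices with label $i$ by label $j$; join every vertex labelled $i$ to every vertex labelled $j$ by an edge ($i\neq j$). *)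

(* Defs.v *)
From mathcomp Require Import all_boot.

Set Implicit Arguments.
Unset Strict Implicit.
Unset Printing Implicit Defensive.

Record sgraph := SGraph {
  vertex :> finType;
  adj : rel vertex;
  adj_sym : symmetric adj;
  adj_irr : irreflexive adj }.

Definition isomorphic (G H : sgraph) : Prop :=
  exists2 f : G -> H, bijective f & {mono f : x y / adj x y}.

Section Induced.
Variables (G : sgraph) (S : {set G}).

Definition induced_adj : rel {x : G | x \in S} :=
  [rel x y | adj (val x) (val y)].

Lemma induced_adj_sym : symmetric induced_adj.
Proof. by move=> x y; apply: adj_sym. Qed.

Lemma induced_adj_irr : irreflexive induced_adj.
Proof. by move=> x; apply: adj_irr. Qed.

Definition induced : sgraph := SGraph induced_adj_sym induced_adj_irr.
End Induced.

Definition free (L : sgraph -> Prop) (G : sgraph) : Prop :=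
  forall H : sgraph, L H -> forall S : {set G}, ~ isomorphic H (induced S).

Section EdgeGraph.
Variables (n : nat) (s : seq (nat * nat)).

(* The pairs in s are unordered; loops and out-of-range pairs are ignored. *)
Definition edge_adj : rel 'I_n :=
  [rel i j : 'I_n | (i != j) &&
    (((i : nat, j : nat) \in s) || ((j : nat, i : nat) \in s))].

Lemma edge_adj_sym : symmetric edge_adj.
Proof. by move=> i j; rewrite /edge_adj /= eq_sym orbC. Qed.

Lemma edge_adj_irr : irreflexive edge_adj.
Proof. by move=> i; rewrite /edge_adj /= eqxx. Qed.

Definition edge_graph : sgraph := SGraph edge_adj_sym edge_adj_irr.
End EdgeGraph.

Definition claw : sgraph := edge_graph 4 [:: (0, 1); (0, 2); (0, 3)].

Definition four_K1 : sgraph := edge_graph 4 [::].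

(* u, v, a, b, c, d are 0, 1, 2, 3, 4, 5; the edge uv is shared by the cliques
   {u, v, a, b} and {u, v, c, d}. *)
Definition bridge : sgraph :=
  edge_graph 6 [:: (0, 1);
                   (0, 2); (0, 3); (1, 2); (1, 3); (2, 3);
                   (0, 4); (0, 5); (1, 4); (1, 5); (4, 5)].

(* The chordless cycle 0-1-4-2-0, with 3 an adjacent twin of 0. *)
Definition C4_twin : sgraph :=
  edge_graph 5 [:: (0, 1); (0, 2); (3, 1); (3, 2); (1, 4); (2, 4); (0, 3)].

Definition clique (G : sgraph) (K : {set G}) : bool :=
  [forall x in K, forall y in K, (x != y) ==> adj x y].

Definition clique_number (G : sgraph) : nat :=
  \max_(K : {set G} | clique K) #|K|.

Definition colorable (G : sgraph) (k : nat) : bool :=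
  [exists c : {ffun G -> 'I_k}, forall x, forall y, adj x y ==> (c x != c y)].

Lemma colorable_exists (G : sgraph) : exists k, colorable G k.
Proof.
exists #|G|; apply/existsP; exists [ffun x => enum_rank x].
apply/forallP => x; apply/forallP => y; apply/implyP => xy.
rewrite !ffunE; apply: contraTneq xy => /enum_rank_inj ->.
by rewrite adj_irr.
Qed.

Definition chromatic_number (G : sgraph) : nat := ex_minn (colorable_exists G).

Definition perfect (G : sgraph) : Prop :=
  forall S : {set G},
    chromatic_number (induced S) = clique_number (induced S).

Record lgraph (k : nat) := LGraph {
  lgraph_graph :> sgraph;
  label : lgraph_graph -> 'I_k }.

Section LabelledOperations.
Variable k : nat.

Lemma vertex_adj_sym : symmetric [rel _ _ : unit | false].
Proof. by []. Qed.

Lemma vertex_adj_irr : irreflexive [rel _ _ : unit | false].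
Proof. by []. Qed.

Definition lvertex (i : 'I_k) : lgraph k :=
  @LGraph k (SGraph vertex_adj_sym vertex_adj_irr) (fun=> i).

Definition union_adj (A B : sgraph) : rel (A + B)%type :=
  fun x y => match x, y with
             | inl a, inl a' => adj a a'
             | inr b, inr b' => adj b b'
             | _, _ => false
             end.

Lemma union_adj_sym (A B : sgraph) : symmetric (@union_adj A B).
Proof. by move=> [x|x] [y|y] //=; apply: adj_sym. Qed.

Lemma union_adj_irr (A B : sgraph) : irreflexive (@union_adj A B).
Proof. by move=> [x|x] /=; apply: adj_irr. Qed.

Definition lunion (A B : lgraph k) : lgraph k :=
  @LGraph k (SGraph (@union_adj_sym A B) (@union_adj_irr A B))
    (fun x => match x with inl a => label a | inr b => label b end).

Definition lrelabel (i j : 'I_k) (A : lgraph k) : lgraph k :=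
  @LGraph k A (fun x => if label x == i then j else label x).

Definition join_adj (i j : 'I_k) (A : lgraph k) : rel A :=
  [rel x y | [|| adj x y, (label x == i) && (label y == j)
               | (label x == j) && (label y == i)]].

Lemma join_adj_sym (i j : 'I_k) (A : lgraph k) : symmetric (@join_adj i j A).
Proof.
move=> x y; rewrite /join_adj /= adj_sym; congr (_ || _).
by rewrite orbC ![(label x == _) && _]andbC.
Qed.

Lemma join_adj_irr (i j : 'I_k) (A : lgraph k) :
  i != j -> irreflexive (@join_adj i j A).
Proof.
move=> ij x; rewrite /join_adj /= adj_irr /= andbC orbb.
by apply: contraNF ij => /andP[/eqP <- /eqP <-].
Qed.

Definition ljoin (i j : 'I_k) (ij : i != j) (A : lgraph k) : lgraph k :=
  @LGraph k (SGraph (@join_adj_sym i j A) (join_adj_irr ij)) (@label k A).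

Inductive cw_built : lgraph k -> Prop :=
  | cw_vertex i : cw_built (lvertex i)
  | cw_union A B : cw_built A -> cw_built B -> cw_built (lunion A B)
  | cw_relabel i j A : cw_built A -> cw_built (lrelabel i j A)
  | cw_join i j (ij : i != j) A : cw_built A -> cw_built (ljoin ij A).
End LabelledOperations.

Definition cw_constructible (G : sgraph) (k : nat) : Prop :=
  exists2 A : lgraph k, cw_built A & isomorphic A G.

(* A relation rather than a function: the graph with no vertices cannot be
   built by the four operations, and it alone has no clique-width. *)
Definition is_clique_width (G : sgraph) (w : nat) : Prop :=
  cw_constructible G w /\ forall k, cw_constructible G k -> w <= k.

Definition clique_width_at_most (G : sgraph) (k : nat) : Prop :=
  exists2 w, is_clique_width G w & w <= k.

(* Main.v *)
Require Import Defs.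
From mathcomp Require Import all_boot.
From Stdlib Require Import Classical.

(** Every graph of the class with a vertex has bounded clique-width, and the
    graph with no vertices is perfect.

    Everything is read in the complement h of G, where the excluded graphs are
    K3+K1 (claw), K4, C4+2K1 (bridge) and P3+K2 (C4-twin).

    The vertices fall into a bounded number of stable sets of h
    ([coloring_exists]): sort them by their adjacency to a triangle, or to an
    edge if there is no triangle; each sort induces maximum degree at most 1.

    Between two stable sets, exclusion of P3+K2 says that of two rows of the
    bipartite adjacency matrix either one contains the other, or each has
    exactly one entry of its own; hence rows of different sizes are nested, and
    C4+2K1 cuts every chain of nested rows at length 4 ([size_row_sizes]).
    Among rows of equal size every column is constant up to one entry
    ([column_dichotomy]). Refining the stable sets by row sizes and by these
    constants gives boundedly many classes such that, between two classes with
    at least three vertices, h is empty or complete up to a matching: the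
    matching of deviant pairs.

    If x, y, z lie in three classes and xy and yz are deviant in large
    matchings, then so is xz: in each of the eight combinations of empty and
    complete, an otherwise non-deviant xz produces a P3+K2 or a K3+K1, the
    missing vertices coming from other pairs of the matchings
    ([deviant_trans]). So, apart from a bounded set of irregular vertices (those
    of small classes or in small matchings), deviance is an equivalence with at
    most one vertex of each class in a block. Take the irregular vertices as one
    further block with a label for each of them, and record the adjacency to
    them in the labels of the others: adjacency between blocks then depends on
    labels only ([blob_decomposition]).

    Such a graph is built block after block, with two copies of the labels, for
    the block under construction and for the finished ones
    ([cw_constructible_blobs]). *)

Set Implicit Arguments.
Unset Strict Implicit.
Unset Printing Implicit Defensive.

(** * Constructing graphs with blocks *)

Section PartialConstruction.
Variables (G : sgraph) (Lab : finType).
Implicit Types (S : {set G}) (lam : G -> Lab) (R : rel G).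

(** The relation R is a parameter rather than the adjacency of G, since the
    intermediate steps of a construction have not yet all the edges. The empty
    set is admitted although no expression builds it, so that inductions can
    start there. *)
Definition cw_partial S lam R : Prop :=
  S = set0 \/ exists (A : lgraph #|Lab|) (phi : A -> G),
    [/\ cw_built A, injective phi, forall v, (v \in S) = (v \in codom phi),
        forall a, label a = enum_rank (lam (phi a))
      & forall a b, adj a b = R (phi a) (phi b)].

Lemma eq_cw_partial S S' lam lam' R R' :
  S =i S' -> {in S, lam =1 lam'} -> {in S &, R =2 R'} ->
  cw_partial S lam R -> cw_partial S' lam' R'.
Proof.
move=> /setP <- eql eqR [->|[A [phi [bA phiI imS lE aE]]]]; first by left.
have phiS a : phi a \in S by rewrite imS codom_f.
right; exists A, phi; split=> // [a|a b]; first by rewrite lE eql.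
by rewrite aE eqR.
Qed.

Lemma cw_partial_relabel S lam R (i j : Lab) :
  cw_partial S lam R ->
  cw_partial S (fun x => if lam x == i then j else lam x) R.
Proof.
case=> [->|[A [phi [bA phiI imS lE aE]]]]; first by left.
right; exists (lrelabel (enum_rank i) (enum_rank j) A), phi.
split=> // [|a]; first exact: cw_relabel.
rewrite /= lE (inj_eq enum_rank_inj).
by case: eqP => // _; rewrite lE.
Qed.

Lemma cw_partial_join S lam R (i j : Lab) : i != j ->
  cw_partial S lam R ->
  cw_partial S lam (fun x y => [|| R x y, (lam x == i) && (lam y == j)
                                 | (lam x == j) && (lam y == i)]).
Proof.
move=> ij [->|[A [phi [bA phiI imS lE aE]]]]; first by left.
have ij' : enum_rank i != enum_rank j by rewrite (inj_eq enum_rank_inj).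
right; exists (ljoin ij' A), phi; split=> //; first exact: cw_join.
by move=> a b; rewrite /= /join_adj /= aE !lE !(inj_eq enum_rank_inj).
Qed.

Lemma cw_partial_add S lam R v : v \notin S -> 
  (forall x, R x v = false) -> (forall x, R v x = false) ->
  cw_partial S lam R -> cw_partial (v |: S) lam R.
Proof.
move=> vS Rxv Rvx; case=> [->|[A [phi [bA phiI imS lE aE]]]]; right.
  exists (lvertex (enum_rank (lam v))), (fun=> v); split=> //.
  - exact: cw_vertex.
  - by move=> [] [].
  - move=> x; rewrite in_setU1 in_set0 orbF.
    apply/eqP/codomP => [->|[]//].
    by exists tt.
exists (lunion A (lvertex (enum_rank (lam v)))),
  (fun x => match x with inl a => phi a | inr _ => v end); split.
- by apply: cw_union => //; apply: cw_vertex.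
- have nphi a : phi a <> v by move=> e; rewrite -e imS codom_f in vS.
  move=> [a|[]] [b|[]] // => [/phiI -> //|/nphi //|/esym/nphi //].
- move=> x; rewrite in_setU1 imS; apply/orP/codomP.
    by case=> [/eqP ->|/codomP[a ->]]; [exists (inr tt) | exists (inl a)].
  by move=> [[a|b] ->]; [right; apply: codom_f | left].
- by move=> [a|b] //=; rewrite lE.
- by move=> [a|[]] [b|[]] //=; rewrite ?aE ?Rxv ?Rvx.
Qed.

(** As i is not among the labels in s, the joins are independent of each
    other. *)
Lemma cw_partial_joins S lam R (i : Lab) (s : seq Lab) : i \notin s ->
  cw_partial S lam R ->
  cw_partial S lam (fun x y => [|| R x y, (lam x == i) && (lam y \in s)
                                 | (lam x \in s) && (lam y == i)]).
Proof.
elim: s R => [|j s IHs] R.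
  move=> _; apply: eq_cw_partial => // x y _ _.
  by rewrite !in_nil andbF andFb !orbF.
rewrite inE negb_or => /andP[ij iNs] /(cw_partial_join ij) /(IHs _ iNs).
apply: eq_cw_partial => // x y _ _; rewrite !inE.
by do !case: (_ == _); do !case: (_ \in _); case: (R x y).
Qed.

End PartialConstruction.

(** The blobs, i.e. the classes of e, are built one after the other. The
    boolean in a label marks the vertices of the unfinished blob, among which
    the label in L identifies a vertex; None is the label of a vertex on its
    arrival. *)
Section Blobs.
Variables (G : sgraph) (L : finType) (c : G -> L) (f : rel L) (e : rel G).
Hypothesis eE : equivalence_rel e.
Hypothesis cI : forall x y, e x y -> c x = c y -> x = y.
Hypothesis adjE : forall x y, ~~ e x y -> adj x y = f (c x) (c y).

Let Lab := option (L * bool).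
Let ee x : e x x. Proof. by have /(_ x x x)[] := eE. Qed.
Let es x y : e x y = e y x.
Proof.
apply/idP/idP=> exy; first by have /(_ x y x)[_ /(_ exy) <-] := eE; rewrite ee.
by have /(_ y x y)[_ /(_ exy) <-] := eE; rewrite ee.
Qed.
Let et x y : e x y -> e x =1 e y.
Proof. by move=> exy z; have /(_ x y z)[_ /(_ exy)] := eE. Qed.

Let lab (P : {set G}) (x : G) : Lab := Some (c x, x \in P).

(** The vertex v arrives with the label None, so one join per label suffices:
    in the unfinished blob P a label determines its vertex, and outside P the
    adjacency to v depends on the label only. *)
Let add_vertex (S P : {set G}) v :
  {in P, forall x, e x v} -> {in S, forall x, x \notin P -> ~~ e x v} ->
  v \notin S -> P \subset S ->
  cw_partial S (lab P) (@adj G) -> cw_partial (v |: S) (lab (v |: P)) (@adj G).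
Proof.
move=> eP eS vS PS bS.
pose lam x : Lab := if x == v then None else lab P x.
pose R : rel G := fun x y => [&& x != v, y != v & adj x y].
have vx x : x \in S -> (x == v) = false.
  by move=> xS; apply: contraNF vS => /eqP <-.
have: cw_partial (v |: S) lam R.
  apply: cw_partial_add => //; try by move=> x; rewrite /R eqxx ?andbF.
  apply: eq_cw_partial bS => // [x xS|x y xS yS]; first by rewrite /lam vx.
  by rewrite /R !vx.
pose meets_v (i : Lab) := if i is Some (l, b) then
  if b then [exists x in P, (c x == l) && adj x v] else f (c v) l else false.
pose s := [seq i <- enum {: Lab} | meets_v i].
have Ns : None \notin s by rewrite mem_filter.
move/(cw_partial_joins Ns)/(cw_partial_relabel None (Some (c v, true))).
have sE x : x \in S -> (lam x \in s) = adj v x.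
  move=> xS; rewrite mem_filter mem_enum andbT /lam vx //=; case: ifPn => xP.
    apply/exists_inP/idP => [[y yP /andP[/eqP cxy]]|vx'].
      suff -> : y = x by rewrite adj_sym.
      have [eyv exv] := (eP y yP, eP x xP).
      by apply: cI => //; rewrite (et eyv) es.
    by exists x => //; rewrite eqxx adj_sym.
  by rewrite -adjE // es eS.
have lv : lam v = None by rewrite /lam eqxx.
have ln x : x \in S -> (lam x == None) = false by move=> xS; rewrite /lam vx.
apply: eq_cw_partial => // [x|x y].
  case/setU1P=> [->|xS]; first by rewrite lv /= /lab !inE eqxx.
  by rewrite ln // /lam vx // /lab !inE vx.
case/setU1P=> [->|xS] /setU1P[->|yS]; rewrite ?lv ?ln ?eqxx ?(negPf Ns) ?sE //=.
- by rewrite /R eqxx adj_irr.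
- by rewrite /R eqxx /= orbF.
- by rewrite /R eqxx andbF /= andbT adj_sym.
- by rewrite /R !vx //= !(andbF, orbF).
Qed.

Let add_vertices (S P : {set G}) (s : seq G) v : uniq s ->
  {in s, forall x, e v x} -> {in P, forall x, e v x} ->
  {in S, forall x, x \notin P -> ~~ e v x} ->
  {in s, forall x, x \notin S} -> P \subset S ->
  cw_partial S (lab P) (@adj G) ->
  cw_partial (S :|: [set x in s]) (lab (P :|: [set x in s])) (@adj G).
Proof.
elim: s S P => [|x s IHs] S P.
  have -> : [set x in [::] : seq G] = set0 by apply/setP => x; rewrite !inE.
  by rewrite !setU0.
move=> /= /andP[xs us] evs evP evS sS PS bS.
have exs : x \in x :: s by rewrite mem_head.
have h A : A :|: [set y in x :: s] = (x |: A) :|: [set y in s].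
  by apply/setP=> y; rewrite !inE orbCA orbA.
rewrite !h; apply: IHs => //.
- by move=> y ys; rewrite evs // inE ys orbT.
- by move=> y /setU1P[->|/evP//]; rewrite evs.
- move=> y; rewrite !inE => /orP[/eqP ->|yS]; rewrite ?eqxx // negb_or.
  by case/andP=> _; apply: evS.
- move=> y ys; rewrite !inE negb_or sS ?inE ?ys ?orbT // andbT.
  by apply: contraNneq xs => <-.
- by apply: setUS.
- apply: add_vertex => //.
  + move=> y yP; have [vy vx] := (evP y yP, evs x exs).
    by rewrite -(et vy).
  + move=> y yS yP; have vx := evs x exs.
    by rewrite es -(et vx); apply: evS.
  + exact: sS.
Qed.

Let finish_blob (S P : {set G}) :
  cw_partial S (lab P) (@adj G) -> cw_partial S (lab set0) (@adj G).
Proof.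
(* The marks are erased label by label; s lists the labels already done. *)
pose lamq (s : seq L) x : Lab := Some (c x, (c x \notin s) && (x \in P)).
suff h s : cw_partial S (lab P) (@adj G) -> cw_partial S (lamq s) (@adj G).
  move/(h (enum L)); apply: eq_cw_partial => // x _.
  by rewrite /lamq /lab mem_enum !inE.
move=> bS; elim: s => [|l s /(cw_partial_relabel (Some (l, true)) (Some (l, false)))].
  exact: bS.
apply: eq_cw_partial => // x _; rewrite /lamq /= inE negb_or.
have [->|ne] := eqVneq (c x) l; rewrite /=.
  by case: ((l \notin s) && (x \in P)); rewrite ?eqxx ?if_same.
by case: ifP => // /eqP[/eqP]; rewrite (negPf ne).
Qed.

Lemma cw_partial_blobs : cw_partial [set: G] (lab set0) (@adj G).
Proof.
suff h n (S : {set G}) : #|S| <= n -> {in S, forall x y, e x y -> y \in S} ->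
    cw_partial S (lab set0) (@adj G).
  exact: (h #|[set: G]|).
elim: n S => [|n IHn] S; first by rewrite leqn0 cards_eq0 => /eqP -> _; left.
have [->|[v vS]] := set_0Vmem S; first by left.
move=> Sn eS; pose B := [set x in S | e v x].
have BS : B \subset S by apply/subsetP => x; rewrite inE => /andP[].
have: cw_partial (S :\: B) (lab set0) (@adj G).
  apply: IHn.
    rewrite -ltnS; apply: leq_trans Sn; rewrite cardsD (setIidPr BS).
    have vB : v \in B by rewrite inE vS ee.
    have B0 : 0 < #|B| by apply/card_gt0P; exists v.
    by rewrite ltn_subrL B0 (leq_trans B0) // subset_leq_card.
  move=> x; rewrite !inE => /andP[xB xS] y exy; rewrite xS /= in xB.
  rewrite !inE (eS x xS y exy) /= andbT; apply: contra xB => evy.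
  by rewrite (et evy) es.
move=> bS; have/finish_blob : cw_partial ((S :\: B) :|: [set x in enum B])
    (lab (set0 :|: [set x in enum B])) (@adj G).
  apply: (add_vertices (v := v)) bS => [|x|x|x|x|].
  - exact: enum_uniq.
  - by rewrite mem_enum inE => /andP[].
  - by rewrite inE.
  - by rewrite !inE => /andP[+ xS]; rewrite xS.
  - by rewrite mem_enum !inE => /andP[-> ->].
  - exact: sub0set.
apply: eq_cw_partial => // x.
by rewrite !inE mem_enum !inE; case: (x \in S); rewrite ?andbF // andbT orNb.
Qed.

Lemma cw_constructible_blobs :
  0 < #|G| -> cw_constructible G #|{: option (L * bool)}|.
Proof.
move=> /card_gt0P[v _]; case: cw_partial_blobs => [/setP/(_ v)|].
  by rewrite !inE.
move=> [A [phi [bA phiI imS _ aE]]]; exists A => //; exists phi.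
  have [g g1 g2] : {g | cancel phi g & cancel g phi}; last by exists g.
  have im x : x \in codom phi by rewrite -imS inE.
  exists (fun x => iinv (im x)) => x; last by rewrite f_iinv.
  by apply: phiI; rewrite f_iinv.
by move=> a b; rewrite aE.
Qed.
End Blobs.

(** * The excluded graphs, in the complement *)

(** Distinctness of two vertices is assumed only where the adjacencies do not
    imply it. *)
Section ForbiddenPatterns.
Variables (T : finType) (h : rel T).

Definition K4_free := forall a b c d,
  h a b -> h a c -> h a d -> h b c -> h b d -> h c d -> False.

Definition K3_K1_free := forall a b c d,
  h a b -> h b c -> h a c -> ~~ h d a -> ~~ h d b -> ~~ h d c -> False.

Definition P3_K2_free := forall a b c d e,
  h a b -> h b c -> a != c -> ~~ h a c -> h d e ->
  ~~ h d a -> ~~ h d b -> ~~ h d c -> ~~ h e a -> ~~ h e b -> ~~ h e c -> False.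

Definition C4_2K1_free := forall a b a' b' d e,
  h a b -> h b a' -> h a' b' -> h b' a ->
  a != a' -> ~~ h a a' -> b != b' -> ~~ h b b' -> d != e -> ~~ h d e ->
  ~~ h d a -> ~~ h d b -> ~~ h d a' -> ~~ h d b' ->
  ~~ h e a -> ~~ h e b -> ~~ h e a' -> ~~ h e b' -> False.

End ForbiddenPatterns.

(** * A bounded number of stable sets *)

Section Structure.
Variables (T : finType) (h : rel T).
Hypotheses (hC : symmetric h) (hI : irreflexive h).
Hypothesis noK4 : K4_free h.
Hypothesis noK3K1 : K3_K1_free h.
Hypothesis noP3K2 : P3_K2_free h.
Hypothesis noC42K1 : C4_2K1_free h.

(** Each part of pat induces a matching, whose edges are split by an arbitrary
    order of the vertices. *)
Lemma matching_coloring (P : finType) (pat : T -> P) :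
  (forall x y z, pat x = pat y -> pat y = pat z -> h x y -> h y z -> x = z) ->
  exists col : T -> P * bool, forall x y, h x y -> col x != col y.
Proof.
move=> deg1; pose up x := [exists y, [&& pat y == pat x, h x y & enum_rank x < enum_rank y]].
exists (fun x => (pat x, up x)) => x y hxy; apply/eqP => -[pxy uxy].
wlog ltxy : x y hxy pxy uxy / enum_rank x < enum_rank y.
  move=> W; case: (ltngtP (enum_rank x) (enum_rank y)) => [|lt|/val_inj/enum_rank_inj e].
  - exact: W hxy pxy uxy.
  - by apply: W lt => //; rewrite hC.
  - by rewrite e hI in hxy.
have: up x by apply/existsP; exists y; rewrite pxy eqxx hxy.
rewrite uxy => /existsP[z /and3P[/eqP pzy hyz ltyz]].
move: ltyz; rewrite -(deg1 x y z) //.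
by rewrite ltnNge ltnW.
Qed.

Definition palette := (bool * bool * bool * bool)%type.

(** A path x, y, z anticomplete to an edge is a triangle, hence a K3+K1, or a
    P3+K2. *)
Lemma far_edge_deg1 u v x y z : h u v ->
  (forall w, w \in [:: x; y; z] -> ~~ h u w /\ ~~ h v w) ->
  h x y -> h y z -> x = z.
Proof.
move=> huv far hxy hyz; apply/eqP; apply: contraT => nxz.
have [ux vx] : ~~ h u x /\ ~~ h v x by apply: far; rewrite !inE eqxx.
have [uy vy] : ~~ h u y /\ ~~ h v y by apply: far; rewrite !inE eqxx orbT.
have [uz vz] : ~~ h u z /\ ~~ h v z by apply: far; rewrite !inE eqxx !orbT.
case: (boolP (h x z)) => hxz; first by case: (@noK3K1 x y z u).
by case: (@noP3K2 x y z u v).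
Qed.

Lemma coloring_exists : exists col : T -> palette, forall x y, h x y -> col x != col y.
Proof.
have [[a [b [c [hab hbc hac]]]]|noK3] :=
  classic (exists a b c, [/\ h a b, h b c & h a c]).
  (* If x - y - z is a path inside a part, then x has exactly one neighbour
     among any two vertices of the triangle: two give a K4 with y, none is
     excluded by far_edge_deg1. Three vertices cannot be so divided. *)
  apply: (@matching_coloring _ (fun x => (h x a, h x b, h x c))) => x y z.
  move=> pxy pyz hxy hyz; apply/eqP; apply: contraT => nxz.
  have one u v : h u v -> h x u = h y u -> h x v = h y v ->
      h y u = h z u -> h y v = h z v -> h x u = ~~ h x v.
    move=> huv xu xv yu yv; case hu: (h x u); case hv: (h x v) => //.
      by case: (@noK4 x y u v); rewrite // -?xu -?xv.
    case/eqP: nxz; apply: (far_edge_deg1 huv _ hxy hyz) => w.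
    rewrite !inE ![h _ w]hC.
    by case/or3P=> /eqP->; rewrite -?yu -?yv -?xu -?xv hu hv.
  case: pxy pyz => xa xb xc [ya yb yc].
  have := one _ _ hac xa xc ya yc; have := one _ _ hbc xb xc yb yc.
  by rewrite (one _ _ hab xa xb ya yb) => ->; case: (h x c).
have [[a [b hab]]|noK2] := classic (exists a b, h a b); last first.
  apply: (@matching_coloring _ (fun=> (true, true, true))) => x y z _ _ hxy.
  by case: noK2; exists x, y.
apply: (@matching_coloring _ (fun x => (h x a, h x b, true))) => x y z.
case=> xa xb [ya yb] hxy hyz; have no u : h x u = h y u -> ~~ h x u.
  by move=> xu; apply/negP => hxu; case: noK3; exists x, y, u; rewrite -xu.
have [nxa nxb] := (no _ xa, no _ xb).
apply: (far_edge_deg1 hab _ hxy hyz) => w; rewrite !inE ![h _ w]hC.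
by case/or3P=> /eqP->; rewrite -?ya -?yb -?xa -?xb.
Qed.

(** * The adjacency between two stable sets *)

Section Coloured.
Variables (C : finType) (col : T -> C).
Hypothesis colP : forall x y, h x y -> col x != col y.

Lemma same_color_nonadj x y : col x = col y -> ~~ h x y.
Proof. by move=> e; apply/negP => /colP; rewrite e eqxx. Qed.

(** This is P3+K2 with the path y - x - y' and the edge x'z. In matrix terms: of
    two rows between the same colour classes, either one contains the other or
    each exceeds the other by exactly one vertex. *)
Lemma no_crossing x x' y y' z :
  col x = col x' -> col y = col y' -> col y = col z -> y != y' ->
  h x y -> h x y' -> ~~ h x z -> ~~ h x' y -> ~~ h x' y' -> h x' z -> False.
Proof.
move=> cx cy cz yy' hxy hxy' hxz hx'y hx'y' hx'z.
apply: (@noP3K2 y x y' x' z) => //; try by rewrite // hC.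
- exact: same_color_nonadj.
- exact: same_color_nonadj.
- exact: same_color_nonadj.
- by rewrite same_color_nonadj // -cz.
Qed.

Definition row j x := [set y | col y == j & h x y].

Lemma in_row j x y : (y \in row j x) = (col y == j) && h x y.
Proof. by rewrite inE. Qed.

Lemma row_exchange j x x' y :
  #|row j x| <= #|row j x'| -> col y = j -> h x y -> ~~ h x' y ->
  exists z, [/\ col z = j, h x' z & ~~ h x z].
Proof.
move=> le cy hxy hx'y.
have: ~~ (row j x' \subset row j x).
  apply: contraL le => sub; rewrite -ltnNge; apply: proper_card.
  apply/properP; split=> //; exists y; rewrite in_row cy eqxx //.
case/subsetPn => z; rewrite !in_row => /andP[/eqP cz hz]; rewrite cz eqxx.
by exists z.
Qed.

Lemma row_lt_sub j x x' : col x = col x' -> #|row j x| < #|row j x'| ->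
  row j x \subset row j x'.
Proof.
move=> cx lt; apply/subsetP => z zx; apply/negPn/negP => zx'.
have: 1 < #|row j x' :\: row j x|.
  have := cardsID (row j x') (row j x); have := cardsID (row j x) (row j x').
  have: 0 < #|row j x :\: row j x'| by apply/card_gt0P; exists z; rewrite inE zx zx'.
  rewrite setIC => lt0 e1 e2; rewrite -e1 -e2 ltn_add2l in lt.
  exact: leq_trans lt.
case/card_gt1P => y [y' []]; rewrite !in_setD !in_row.
move: zx zx'; rewrite !in_row => /andP[/eqP cz xz]; rewrite cz eqxx /= => zx'.
move=> /andP[+ /andP[/eqP cy x'y]] /andP[+ /andP[/eqP cy' x'y']] yy'.
rewrite cy cy' eqxx /= => xy xy'.
by apply: (@no_crossing x' x y y' z) => //; rewrite ?cy ?cy' ?cz.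
Qed.

Definition row_sizes i j := undup [seq #|row j x| | x <- enum T & col x == i].

(** Rows of five different sizes are nested. With the indices of increasing
    size, a vertex that is new in the row of x2 and one that is new in the row
    of x3 form a C4 with x3 and x4, from which x0 and x1 are isolated. *)
Lemma size_row_sizes i j : size (row_sizes i j) <= 4.
Proof.
rewrite leqNgt; apply/negP => gt4; pose s := sort leq (row_sizes i j).
have ss : sorted ltn s.
  by rewrite ltn_sorted_uniq_leq sort_uniq undup_uniq sort_sorted //; apply: leq_total.
have ex k : k < 5 -> exists x, col x = i /\ #|row j x| = nth 0 s k.
  move=> k5; have: nth 0 s k \in s by rewrite mem_nth // size_sort (leq_trans k5).
  rewrite mem_sort mem_undup => /mapP[x]; rewrite mem_filter => /andP[/eqP cx _] e.
  by exists x.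
have lt k : k < 4 -> nth 0 s k < nth 0 s k.+1.
  move=> k4; apply: (sorted_ltn_nth ltn_trans) => //; rewrite inE size_sort.
    by rewrite (leq_trans _ gt4) // ltnW.
  by rewrite (leq_trans _ gt4).
have [x0 [c0 e0]] := ex 0 isT; have [x1 [c1 e1]] := ex 1 isT.
have [x2 [c2 e2]] := ex 2 isT; have [x3 [c3 e3]] := ex 3 isT.
have [x4 [c4 e4]] := ex 4 isT.
have := lt 0 isT; have := lt 1 isT; have := lt 2 isT; have := lt 3 isT.
rewrite -e0 -e1 -e2 -e3 -e4 => l3 l2 l1 l0.
have /subsetP s01 := row_lt_sub (etrans c0 (esym c1)) l0.
have /subsetP s12 := row_lt_sub (etrans c1 (esym c2)) l1.
have /subsetP s23 := row_lt_sub (etrans c2 (esym c3)) l2.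
have /subsetP s34 := row_lt_sub (etrans c3 (esym c4)) l3.
have ex_new x x' : #|row j x| < #|row j x'| -> exists2 y, y \in row j x' & y \notin row j x.
  move=> l; apply/subsetPn; apply/negP => /subset_leq_card.
  by rewrite leqNgt l.
have [y y2 y1] := ex_new _ _ l1; have [z z3 z2] := ex_new _ _ l2.
have z1 : z \notin row j x1 by apply: contra z2; apply: s12.
have y0 : y \notin row j x0 by apply: contra y1; apply: s01.
have z0 : z \notin row j x0 by apply: contra z1; apply: s01.
have y3 := s23 _ y2; have y4 := s34 _ y3; have z4 := s34 _ z3.
have yz : y != z by apply: contraNneq z2 => <-.
have n34 : x3 != x4 by apply: contraTneq l3 => ->; rewrite ltnn.
have n01' : x0 != x1 by apply: contraTneq l0 => ->; rewrite ltnn.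
move: y3 y4 z3 z4 y0 y1 z0 z1; rewrite !in_row.
move=> /andP[/eqP cy hy3] /andP[_ hy4] /andP[/eqP cz hz3] /andP[_ hz4].
rewrite cy cz eqxx /= => hy0 hy1 hz0 hz1.
apply: (@noC42K1 x3 y x4 z x0 x1) => //; try by rewrite // hC.
all: by apply: same_color_nonadj; rewrite ?c0 ?c1 ?c3 ?c4 ?cy ?cz.
Qed.

(** The number of different row sizes is at most 4, so the position of a size
    in the list of sizes replaces the size, of which there is no bound. *)
Definition coarse := (C * {ffun C -> 'I_4})%type.

Definition coarse_label x : coarse :=
  (col x, [ffun j => inord (index #|row j x| (row_sizes (col x) j))]).

Lemma coarse_label_row x x' j :
  coarse_label x = coarse_label x' -> #|row j x| = #|row j x'|.
Proof.
case=> cx /ffunP/(_ j); rewrite !ffunE cx => /(congr1 val) /=.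
have mem y : col y = col x' -> #|row j y| \in row_sizes (col x') j.
  by move=> cy; rewrite mem_undup map_f // mem_filter mem_enum cy eqxx.
have small y : col y = col x' -> index #|row j y| (row_sizes (col x') j) < 4.
  by move=> cy; rewrite (leq_trans _ (size_row_sizes (col x') j)) // index_mem mem.
rewrite !inordK ?small // => /(congr1 (nth 0 (row_sizes (col x') j))).
by rewrite !nth_index ?mem.
Qed.

Lemma coarse_label_col x x' : coarse_label x = coarse_label x' -> col x = col x'.
Proof. by case. Qed.

(** Rows of equal size that differ have a vertex of their own each. So x3
    contains a vertex z outside x1, and x4 a vertex w outside x1; by
    [no_crossing] for the columns of y and z, the row of x2 contains z and that
    of x4 does not, and likewise for w. Now x2 exceeds x1 by both z and w, a
    crossing with any vertex of x1 outside x2. *)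
Lemma column_dichotomy y x1 x2 x3 x4 :
  coarse_label x1 = coarse_label x2 -> coarse_label x1 = coarse_label x3 ->
  coarse_label x1 = coarse_label x4 -> x1 != x2 -> x3 != x4 ->
  h x1 y -> h x2 y -> ~~ h x3 y -> ~~ h x4 y -> False.
Proof.
move=> k2 k3 k4 n12 n34 h1 h2 h3 h4.
have c2 := coarse_label_col k2.
have new x x' : coarse_label x1 = coarse_label x -> coarse_label x1 = coarse_label x' ->
  x != x' -> ~~ h x y -> ~~ h x' y ->
  exists z, [/\ col z = col y, h x z, ~~ h x1 z, h x2 z & ~~ h x' z].
  move=> k k' n nx nx'.
  have [|z [cz xz x1z]] := @row_exchange (col y) x1 x y _ erefl h1 nx.
    by rewrite (coarse_label_row _ k).
  have cx : col x1 = col x by apply: coarse_label_col.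
  have cx' : col x = col x' by rewrite -cx; apply: coarse_label_col.
  exists z; split=> //; last first.
    by apply/negP => x'z; apply: (@no_crossing z y x x' x1); rewrite // hC.
  by apply: contraT => x2z; case: (@no_crossing y z x1 x2 x); rewrite // hC.
have [z [cz z3 z1 z2 z4]] := new _ _ k3 k4 n34 h3 h4.
have [|w [cw w4 w1 w2 w3]] := new _ _ k4 k3 _ h4 h3; first by rewrite eq_sym.
have [|u [cu u1 u2]] := @row_exchange (col y) x2 x1 z _ cz z2 z1.
  by rewrite (coarse_label_row _ k2).
apply: (@no_crossing x2 x1 z w u) => //; rewrite ?cz //.
by apply: contraNneq w3 => <-.
Qed.

(** By [column_dichotomy] the column of y is constant on the part p up to one
    entry; this is the constant. *)
Definition base (p : coarse) y := 1 < #|[set x | coarse_label x == p & h x y]|.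

Lemma base_same_color x y : col x = col y -> base (coarse_label x) y = false.
Proof.
move=> c; rewrite /base (_ : [set z | _ & _] = set0) ?cards0 //.
apply/setP => z; rewrite !inE; case: eqP => //= /coarse_label_col cz.
by apply/negbTE/same_color_nonadj; rewrite cz.
Qed.

Lemma exception_unique x x' y :
  coarse_label x = coarse_label x' ->
  h x y != base (coarse_label x) y -> h x' y != base (coarse_label x) y -> x = x'.
Proof.
move=> k; case: (boolP (base _ y)) => [|/negP b]; rewrite ?eqb_id ?eqbF_neg.
  case/card_gt1P=> x1 [x2 []]; rewrite !inE.
  move=> /andP[/eqP k1 h1] /andP[/eqP k2 h2] n12 nx nx'.
  apply/eqP; apply: contraT => nxx'.
  by case: (@column_dichotomy y x1 x2 x x'); rewrite // k1 -?k.
rewrite !negbK => hx hx'; apply/eqP; apply: contraT => nxx'; case: b.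
by apply/card_gt1P; exists x, x'; rewrite !inE -k eqxx hx hx'.
Qed.

(** * Deviant pairs *)

Definition fine := (coarse * {ffun coarse -> bool})%type.
Definition fine_label x : fine := (coarse_label x, [ffun p => base p x]).
(** The conjunction makes the pattern symmetric; for big classes both terms
    agree, see [base_sym]. *)
Definition pattern (l m : fine) := m.2 l.1 && l.2 m.1.
Definition fine_class (l : fine) := [set x | fine_label x == l].
(** Two classes with three vertices cannot follow two different constants. *)
Definition big l := 2 < #|fine_class l|.
Definition deviant x y := h x y != pattern (fine_label x) (fine_label y).

Lemma fine_label_coarse x x' :
  fine_label x = fine_label x' -> coarse_label x = coarse_label x'.
Proof. by move/(congr1 fst). Qed.

Lemma fine_label_base x x' p : fine_label x = fine_label x' -> base p x = base p x'.
Proof. by move/(congr1 snd)/ffunP/(_ p); rewrite !ffunE. Qed.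

Lemma patternE x y : pattern (fine_label x) (fine_label y) =
  base (coarse_label x) y && base (coarse_label y) x.
Proof. by rewrite /pattern !ffunE. Qed.

Lemma patternC l m : pattern l m = pattern m l.
Proof. by rewrite /pattern andbC. Qed.

Lemma deviantC x y : deviant x y = deviant y x.
Proof. by rewrite /deviant hC patternC. Qed.

Lemma conformE x y : ~~ deviant x y -> h x y = pattern (fine_label x) (fine_label y).
Proof. by rewrite negbK => /eqP. Qed.

Lemma deviantE x y : deviant x y -> h x y = ~~ pattern (fine_label x) (fine_label y).
Proof. by rewrite /deviant; case: (h x y); case: pattern. Qed.

Lemma deviant_same_color x y : col x = col y -> deviant x y = false.
Proof.
move=> c; rewrite /deviant patternE base_same_color //.
by rewrite (negPf (same_color_nonadj c)).
Qed.

(** If the constants for rows and for columns differ, each entry of the matrix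
    is an exception to one of them. Each of y1, y2 admits an exception to the
    former with at most one of x1, x2, x3, so one of these three would have
    exceptions to the latter with both y1 and y2. *)
Lemma base_sym x y : big (fine_label x) -> big (fine_label y) ->
  base (coarse_label x) y = base (coarse_label y) x.
Proof.
case/card_gt2P => x1 [x2 [x3 [[]]]]; rewrite !inE => /eqP f1 /eqP f2 /eqP f3 [n12 n23 n31].
case/card_gt2P => y1 [y2 [y3 [[]]]]; rewrite !inE => /eqP g1 /eqP g2 _ [m12 _ _].
have exA x' x'' y' : fine_label x' = fine_label x -> fine_label x'' = fine_label x ->
    fine_label y' = fine_label y -> x' != x'' ->
    (h x' y' != base (coarse_label x) y) ==> (h x'' y' == base (coarse_label x) y).
  move=> fx' fx'' fy' n; apply/implyP => h1; apply: contraNT n => h2.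
  rewrite -(fine_label_base _ fy') -(fine_label_coarse fx') in h1 h2.
  by apply/eqP; apply: exception_unique h1 h2; apply: fine_label_coarse; rewrite fx'.
have exB x' : fine_label x' = fine_label x ->
    (h x' y1 != base (coarse_label y) x) ==> (h x' y2 == base (coarse_label y) x).
  move=> fx'; apply/implyP => h1; apply: contraNT m12 => h2.
  rewrite -(fine_label_base _ fx') -(fine_label_coarse g1) !(hC x') in h1 h2.
  by apply/eqP; apply: exception_unique h1 h2; apply: fine_label_coarse; rewrite g1.
move: (exA _ _ _ f1 f2 g1 n12) (exA _ _ _ f2 f3 g1 n23) (exA _ _ _ f3 f1 g1 n31).
move: (exA _ _ _ f1 f2 g2 n12) (exA _ _ _ f2 f3 g2 n23) (exA _ _ _ f3 f1 g2 n31).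
move: (exB _ f1) (exB _ f2) (exB _ f3).
case: (base (coarse_label x) y); case: (base (coarse_label y) x) => //.
all: case: (h x1 y1); case: (h x2 y1); case: (h x3 y1) => //.
all: by case: (h x1 y2); case: (h x2 y2); case: (h x3 y2).
Qed.

Lemma deviant_unique x x' y : big (fine_label x) -> big (fine_label y) ->
  fine_label x = fine_label x' -> deviant x y -> deviant x' y -> x = x'.
Proof.
move=> bx b_y f; rewrite /deviant -f patternE -(base_sym bx b_y) andbb.
by apply: exception_unique (fine_label_coarse f).
Qed.

(** The endpoints in l of the matching of deviant pairs between l and m. *)
Definition ends (l m : fine) :=
  [set x in fine_class l | [exists y in fine_class m, deviant x y]].

(** A vertex v spoils at most three pairs, by [deviant_unique]: the one with
    l-end v, the one whose l-end is deviant with v (this is also the one with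
    m-end v), and the one whose m-end is deviant with v. *)
Lemma fresh_deviant l m (vs : seq T) : big l -> big m ->
  all (fun v => big (fine_label v)) vs -> 3 * size vs < #|ends l m| ->
  exists x y, [/\ fine_label x = l, fine_label y = m, deviant x y &
    forall v, v \in vs -> [/\ x != v, y != v, ~~ deviant x v & ~~ deviant y v]].
Proof.
move=> bl bm bvs lt.
pose bad v x := [|| x == v, deviant x v |
  [exists y in fine_class m, deviant x y && deviant y v]].
have bad3 v : big (fine_label v) -> #|[set x in fine_class l | bad v x]| <= 3.
  move=> bv.
  pose B := [set x in fine_class l | deviant x v].
  pose B' := [set x in fine_class l |
     [exists y in fine_class m, deviant x y && deviant y v]].
  have sub : [set x in fine_class l | bad v x] \subset [set v] :|: (B :|: B').
    by apply/subsetP => x; rewrite !inE => /andP[-> /=].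
  apply: leq_trans (subset_leq_card sub) _.
  apply: leq_trans (leq_card_setU _ _) _; rewrite cards1 ltnS.
  apply: leq_trans (leq_card_setU _ _) _; apply: (@leq_add _ _ 1 1).
    apply/card_le1_eqP => x x'; rewrite !inE => /andP[/eqP fx dx] /andP[/eqP fx' dx'].
    by apply: (@deviant_unique _ _ v); rewrite ?fx ?fx'.
  apply/card_le1_eqP => x x'; rewrite !inE.
  move=> /andP[/eqP fx /exists_inP[y /[!inE] /eqP fy /andP[xy yv]]].
  move=> /andP[/eqP fx' /exists_inP[y' /[!inE] /eqP fy' /andP[x'y' y'v]]].
  have yy' : y = y' by apply: (@deviant_unique _ _ v); rewrite ?fy ?fy'.
  by apply: (@deviant_unique _ _ y); rewrite ?fx ?fx' ?fy // yy'.
have cov : #|[set x in fine_class l | has (bad^~ x) vs]| <= 3 * size vs.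
  elim: vs bvs {lt} => [_|v vs IH /= /andP[bv bvs]].
    by rewrite leqn0 cards_eq0; apply/eqP/setP => x; rewrite !inE andbF.
  rewrite mulnS; apply: leq_trans (leq_add (bad3 v bv) (IH bvs)).
  apply: leq_trans (leq_card_setU _ _); apply: subset_leq_card.
  by apply/subsetP => x; rewrite !inE => /andP[-> /orP[]->]; rewrite ?orbT.
have : ~~ (ends l m \subset [set x in fine_class l | has (bad^~ x) vs]).
  apply: contraL lt => /subset_leq_card s; rewrite -leqNgt.
  exact: leq_trans cov.
case/subsetPn => x; rewrite !inE => /andP[/eqP fx]; rewrite fx eqxx /=.
case/exists_inP => y; rewrite inE => /eqP fy xy /hasPn good.
exists x, y; split=> // v /good; rewrite !negb_or => /and3P[-> dxv /exists_inPn dyv].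
have dyv' : ~~ deviant y v by have := dyv y; rewrite inE fy eqxx xy; apply.
by split=> //; apply: contraNneq dxv => <-.
Qed.

(** The bound 12 lets [fresh_deviant] avoid the four vertices that
    [deviant_trans] asks for. *)
Definition regular x := big (fine_label x) &&
  [forall m, (x \in ends (fine_label x) m) ==> (12 < #|ends (fine_label x) m|)].

Lemma regular_ends x y : regular x -> deviant x y ->
  12 < #|ends (fine_label x) (fine_label y)|.
Proof.
case/andP=> _ /forallP/(_ (fine_label y))/implyP end_x dxy; apply: end_x.
by rewrite !inE eqxx; apply/exists_inP; exists y; rewrite // inE.
Qed.

(** With fresh deviant pairs x1 y1, x2 y2 (between the classes of x and y) and
    y3 z3 (between those of y and z), the eight values of the three patterns
    each yield a K3+K1 or a P3+K2 if xz is not deviant. *)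
Lemma deviant_trans x y z : regular x -> regular y -> regular z ->
  deviant x y -> deviant y z -> x != z -> deviant x z.
Proof.
move=> rx ry rz dxy dyz nxz; apply: contraT => dxz.
have [/andP[bx _] /andP[b_y _] /andP[bz _]] := And3 rx ry rz.
have lt1 := regular_ends rx dxy; have lt2 := regular_ends ry dyz.
have [||x1 [y1 [fx1 fy1 d1 g1]]] := @fresh_deviant _ _ [:: x; y; z] bx b_y.
- by rewrite /= bx b_y bz.
- exact: leq_trans lt1.
have [||x2 [y2 [fx2 fy2 d2 g2]]] := @fresh_deviant _ _ [:: x; y; z; y1] bx b_y.
- by rewrite /= fy1 bx b_y bz.
- exact: leq_trans lt1.
have [||y3 [z3 [fy3 fz3 d3 g3]]] := @fresh_deviant _ _ [:: x; y; z] b_y bz.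
- by rewrite /= bx b_y bz.
- exact: leq_trans lt2.
have pll w : pattern (fine_label w) (fine_label w) = false.
  by rewrite -conformE ?hI // deviant_same_color.
pose a := pattern (fine_label x) (fine_label y).
pose b := pattern (fine_label y) (fine_label z).
pose c := pattern (fine_label x) (fine_label z).
have hs u v w : h u v = w -> (h u v = w) * (h v u = w) by rewrite (hC v u).
have val u v w t : fine_label u = fine_label w -> ~~ deviant u v ->
    pattern (fine_label w) (fine_label v) = t -> (h u v = t) * (h v u = t).
  by move=> fu /conformE e <-; apply: hs; rewrite e fu.
have := hs _ _ _ (deviantE dxy); have := hs _ _ _ (deviantE dyz).
have := hs _ _ _ (conformE dxz).
have := hs _ _ _ (deviantE d1); have := hs _ _ _ (deviantE d3).
rewrite fx1 fy1 fy3 fz3 -/a -/b -/c => hyz3 hxy1 hxz hyz hxy.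
have inx : x \in [:: x; y; z] by rewrite !inE eqxx.
have iny : y \in [:: x; y; z] by rewrite !inE eqxx orbT.
have inz : z \in [:: x; y; z] by rewrite !inE eqxx !orbT.
have [_ _ dx1x dy1x] := g1 x inx; have [_ _ dx1y dy1y] := g1 y iny.
have [_ _ dx1z dy1z] := g1 z inz.
have [_ _ dy3x dz3x] := g3 x inx; have [_ _ dy3y dz3y] := g3 y iny.
have [_ _ dy3z dz3z] := g3 z inz.
have in2 v : v \in [:: x; y; z] -> v \in [:: x; y; z; y1].
  by rewrite !inE => /or3P[]->; rewrite ?orbT.
have [_ _ _ dy2x] := g2 x (in2 x inx); have [_ _ _ dy2y] := g2 y (in2 y iny).
have [_ _ _ dy2z] := g2 z (in2 z inz).
have [|_ ny2y1 _ dy2y1] := g2 y1; first by rewrite !inE eqxx !orbT.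
have hy2y1 := val y2 y1 y _ fy2 dy2y1 erefl; rewrite fy1 pll in hy2y1.
have pyx : pattern (fine_label y) (fine_label x) = a by rewrite patternC.
have pzx : pattern (fine_label z) (fine_label x) = c by rewrite patternC.
have pzy : pattern (fine_label z) (fine_label y) = b by rewrite patternC.
have h1 := (val _ _ _ _ fx1 dx1x (pll x), val _ _ _ _ fx1 dx1y (erefl a),
            val _ _ _ _ fx1 dx1z (erefl c), val _ _ _ _ fy1 dy1x pyx,
            val _ _ _ _ fy1 dy1y (pll y), val _ _ _ _ fy1 dy1z (erefl b)).
have h2 := (val _ _ _ _ fy2 dy2x pyx, val _ _ _ _ fy2 dy2y (pll y),
            val _ _ _ _ fy2 dy2z (erefl b), hy2y1).
have h3 := (val _ _ _ _ fy3 dy3x pyx, val _ _ _ _ fy3 dy3y (pll y),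
            val _ _ _ _ fy3 dy3z (erefl b), val _ _ _ _ fz3 dz3x pzx,
            val _ _ _ _ fz3 dz3y pzy, val _ _ _ _ fz3 dz3z (pll z)).
have H := (hyz3, hxy1, hxz, hyz, hxy, h1, h2, h3).
(* H is oriented both ways; every adjacency is now a function of a, b, c. *)
move: a b c H {pyx pzx pzy hyz3 hxy1 hxz hyz hxy h1 h2 h3 hy2y1} => [] [] [] H.
- by case: (@noK3K1 x y1 z y); rewrite ?H.
- by case: (@noP3K2 x y1 z y x1); rewrite ?H.
- by case: (@noK3K1 x y3 z3 y); rewrite ?H.
- by case: (@noP3K2 y1 x y2 y z); rewrite ?H // eq_sym.
- by case: (@noK3K1 x1 y1 z y); rewrite ?H.
- by case: (@noP3K2 y1 z y2 x y); rewrite ?H // eq_sym.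
- by case: (@noK3K1 x y z y1); rewrite ?H.
- by case: (@noP3K2 x y z x1 y1); rewrite ?H.
Qed.

Lemma leq_card_bigcup (I : finType) (F : I -> {set T}) k :
  (forall i, #|F i| <= k) -> #|\bigcup_i F i| <= #|I| * k.
Proof.
move=> Fk; rewrite -sum_nat_const; apply: (@leq_trans (\sum_i #|F i|)).
  elim/big_rec2: _ => [|i A s _ As]; first by rewrite cards0.
  by apply: leq_trans (leq_card_setU _ _) _; rewrite leq_add2l.
by apply: leq_sum.
Qed.

Definition irregular_bound := #|{: fine}| * 2 + #|{: fine}| * (#|{: fine}| * 12).

Lemma card_irregular : #|[set x | ~~ regular x]| <= irregular_bound.
Proof.
pose small (A : {set T}) k := if k < #|A| then set0 else A.
have smallP A k : #|small A k| <= k.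
  by rewrite /small; case: ltnP => //; rewrite cards0.
pose S := \bigcup_l small (fine_class l) 2.
pose S' := \bigcup_l \bigcup_m small (ends l m) 12.
apply: (@leq_trans #|S :|: S'|); last first.
  apply: leq_trans (leq_card_setU _ _) _.
  by apply: leq_add; do ?[apply: leq_card_bigcup => ?].
apply: subset_leq_card; apply/subsetP => x; rewrite inE negb_and => irr.
rewrite inE; apply/orP; case/orP: irr => [nb|/forallPn[m]].
  left; apply/bigcupP; exists (fine_label x) => //.
  by rewrite /small ifN // inE.
rewrite negb_imply => /andP[xe nl]; right.
apply/bigcupP; exists (fine_label x) => //; apply/bigcupP; exists m => //.
by rewrite /small ifN.
Qed.

(** An irregular vertex has its own label; a regular one carries its fine label
    and its adjacency to the irregular vertices. *)
Definition index_type := 'I_irregular_bound.+1.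
Definition blob_label := (index_type + fine * {ffun index_type -> bool})%type.

Let irr := enum [set x | ~~ regular x].
Let irr_index x : index_type := inord (index x irr).

Lemma irr_index_inj x y : ~~ regular x -> ~~ regular y ->
  irr_index x = irr_index y -> x = y.
Proof.
move=> nx ny; have mem w : ~~ regular w -> w \in irr by rewrite mem_enum inE.
have lt w : ~~ regular w -> index w irr < irregular_bound.+1.
  move=> /mem; rewrite -index_mem ltnS -cardE => /ltnW/leq_trans; apply.
  exact: card_irregular.
move/(congr1 val); rewrite /= !inordK ?lt // => /(congr1 (nth x irr)).
by rewrite !nth_index ?mem.
Qed.

Let blob x y := [|| x == y, ~~ regular x && ~~ regular y |
  [&& regular x, regular y & deviant x y]].

Let lab x : blob_label := if regular x
  then inr (fine_label x, [ffun i => has (fun w => (irr_index w == i) && h w x) irr])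
  else inl (irr_index x).

Let off (l m : blob_label) := match l, m with
  | inr (p, _), inr (q, _) => pattern p q
  | inl i, inr (_, g) => g i
  | inr (_, g), inl i => g i
  | inl _, inl _ => false
  end.

Lemma blob_decomposition : exists (c : T -> blob_label) (f : rel blob_label) (e : rel T),
  [/\ equivalence_rel e, forall x y, e x y -> c x = c y -> x = y
     & forall x y, ~~ e x y -> h x y = f (c x) (c y)].
Proof.
exists lab, off, blob; split.
- have bC x y : blob x y = blob y x.
    by rewrite /blob eq_sym deviantC; case: (regular x); case: (regular y).
  have bT x y z : blob x y -> blob y z -> blob x z.
    have [->//|nxy] := eqVneq x y; have [->//|nyz] := eqVneq y z.
    rewrite /blob (negPf nxy) (negPf nyz); have [//|nxz] := eqVneq x z.
    case rx: (regular x); case ry: (regular y); case rz: (regular z) => //=.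
    by move=> dxy dyz; apply: deviant_trans dyz _.
  move=> x y z; split; first by rewrite /blob eqxx.
  move=> bxy; apply/idP/idP; last exact: bT.
  by apply: bT; rewrite bC.
- move=> x y; rewrite /blob /lab; have [//|nxy] := eqVneq x y.
  case rx: (regular x); case ry: (regular y) => //= dxy.
    by case=> cxy *; move: dxy; rewrite deviant_same_color.
  by case=> /irr_index_inj -> //; rewrite ?rx ?ry.
- have link x y : ~~ regular x -> regular y -> h x y =
      has (fun w => (irr_index w == irr_index x) && h w y) irr.
    move=> nx ry; apply/idP/hasP => [hxy|[w]].
      by exists x; rewrite ?eqxx // mem_enum inE.
    by rewrite mem_enum inE => nw /andP[/eqP/irr_index_inj->].
  move=> x y; rewrite /blob /lab !negb_or => /and3P[nxy nirr ndev].
  case rx: (regular x) nirr ndev; case ry: (regular y) => //= _.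
  + exact: conformE.
  + by move=> _; rewrite ffunE hC link ?ry.
  + by move=> _; rewrite ffunE link ?rx.
Qed.
End Coloured.
End Structure.

(** * From excluded induced subgraphs to the complement *)

Section Complement.
Variable G : sgraph.

Definition coadj : rel G := fun x y => (x != y) && ~~ adj x y.

Lemma coadjC : symmetric coadj.
Proof. by move=> x y; rewrite /coadj eq_sym adj_sym. Qed.

Lemma coadj_irr : irreflexive coadj.
Proof. by move=> x; rewrite /coadj eqxx. Qed.

Lemma coadj_adj x y : coadj x y -> adj x y = false.
Proof. by case/andP=> _ /negPf. Qed.

Lemma not_coadj_adj x y : x != y -> ~~ coadj x y -> adj x y.
Proof. by rewrite /coadj => ->; rewrite negbK. Qed.

Lemma coadj_neq x y : coadj x y -> x != y.
Proof. by case/andP. Qed.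

Lemma coadj_separates x y z : coadj x y -> ~~ coadj z y -> z != x.
Proof. by move=> xy; apply: contraNneq => ->. Qed.

Variable L : sgraph -> Prop.
Hypothesis freeG : free L G.

Lemma free_no_embedding (H : sgraph) (f : H -> G) :
  L H -> injective f -> {mono f : x y / adj x y} -> False.
Proof.
move=> LH fI fE; pose S := [set f x | x : H].
have fS x : f x \in S by apply: imset_f.
apply: (freeG LH (S := S)); exists (fun x => Sub (f x) (fS x)) => //.
apply: inj_card_bij => [x y [/fI]//|].
by rewrite card_sig card_imset.
Qed.

Lemma free_no_copy n s (x0 : G) (t : seq G) :
  L (edge_graph n s) -> size t = n -> uniq t ->
  (forall i j, i < j -> j < n ->
    adj (nth x0 t i) (nth x0 t j) = ((i, j) \in s) || ((j, i) \in s)) -> False.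
Proof.
move=> LH st ut adjt.
apply: (@free_no_embedding _ (fun i : edge_graph n s => nth x0 t (val (i : 'I_n)))) => //.
  by move=> i j /eqP; rewrite nth_uniq ?st //= => /eqP/val_inj.
move=> i j; rewrite [RHS]/(edge_adj _ _ _) /= -val_eqE /=.
case: (ltngtP (val (i : 'I_n)) (val (j : 'I_n))) => [lt|lt|-> /=].
- by rewrite adjt ?ltn_ord.
- by rewrite adj_sym adjt ?ltn_ord // orbC.
- by rewrite adj_irr.
Qed.
End Complement.

Section ForbiddenComplements.
Variables (G : sgraph) (L : sgraph -> Prop).
Hypothesis freeG : free L G.

Lemma coadj_K4_free : L four_K1 -> K4_free (@coadj G).
Proof.
move=> LH a b c d ab ac ad bc bd cd.
apply: (free_no_copy freeG (x0 := a) (t := [:: a; b; c; d]) LH) => //=.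
  by rewrite !inE !negb_or !coadj_neq.
by case=> [|[|[|[|i]]]] [|[|[|[|j]]]] //= _ _; rewrite coadj_adj.
Qed.

Lemma coadj_K3_K1_free : L claw -> K3_K1_free (@coadj G).
Proof.
move=> LH a b c d ab bc ac da db dc.
have ca : coadj c a by rewrite coadjC.
have [nda ndb ndc] : [/\ d != a, d != b & d != c].
  by split; [apply: coadj_separates ab _|apply: coadj_separates bc _
            |apply: coadj_separates ca _].
apply: (free_no_copy freeG (x0 := a) (t := [:: d; a; b; c]) LH) => //=.
  by rewrite !inE !negb_or nda ndb ndc !coadj_neq.
by case=> [|[|[|[|i]]]] [|[|[|[|j]]]] //= _ _;
  do [exact: coadj_adj | exact: not_coadj_adj].
Qed.

Lemma coadj_P3_K2_free : L C4_twin -> P3_K2_free (@coadj G).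
Proof.
move=> LH a b c d e ab bc nac ac de da db dc ea eb ec.
have cb : coadj c b by rewrite coadjC.
have [nda ndb ndc] : [/\ d != a, d != b & d != c].
  by split; [apply: coadj_separates ab _|apply: coadj_separates bc _
            |apply: coadj_separates cb _].
have [nea neb nec] : [/\ e != a, e != b & e != c].
  by split; [apply: coadj_separates ab _|apply: coadj_separates bc _
            |apply: coadj_separates cb _].
(* In the numbering of C4_twin, the path of the complement is 0 - 4 - 3 and the
   edge is 12. *)
apply: (free_no_copy freeG (x0 := a) (t := [:: a; d; e; c; b]) LH) => //=.
  rewrite !inE !negb_or ![a == d]eq_sym ![a == e]eq_sym.
  by rewrite nac nda ndb ndc nea neb nec !coadj_neq.
case=> [|[|[|[|[|i]]]]] [|[|[|[|[|j]]]]] //= _ _;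
  do [exact: coadj_adj | exact: not_coadj_adj
     | by rewrite adj_sym; exact: not_coadj_adj].
Qed.

Lemma coadj_C4_2K1_free : L bridge -> C4_2K1_free (@coadj G).
Proof.
move=> LH a b a' b' d e ab ba' a'b' b'a naa' aa' nbb' bb' nde de da db da' db' ea eb ea' eb'.
have [nda ndb nda' ndb'] : [/\ d != a, d != b, d != a' & d != b'].
  by split; [apply: coadj_separates ab _|apply: coadj_separates ba' _
            |apply: coadj_separates a'b' _|apply: coadj_separates b'a _].
have [nea neb nea' neb'] : [/\ e != a, e != b, e != a' & e != b'].
  by split; [apply: coadj_separates ab _|apply: coadj_separates ba' _
            |apply: coadj_separates a'b' _|apply: coadj_separates b'a _].
have ab' : coadj a b' by rewrite coadjC.
have a'b : coadj a' b by rewrite coadjC.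
have ed : e != d by rewrite eq_sym.
(* The isolated vertices d, e of the complement are u, v; the two diagonals of
   the 4-cycle are the edges ab and cd of the bridge. *)
apply: (free_no_copy freeG (x0 := a) (t := [:: d; e; a; a'; b; b']) LH) => //=.
  by rewrite !inE !negb_or nde nda ndb nda' ndb' nea neb nea' neb' naa' nbb' !coadj_neq.
by case=> [|[|[|[|[|[|i]]]]]] [|[|[|[|[|[|j]]]]]] //= _ _;
  do [exact: coadj_adj | exact: not_coadj_adj].
Qed.
End ForbiddenComplements.

(** * Conclusion *)

Lemma perfect_card0 (G : sgraph) : #|G| = 0 -> perfect G.
Proof.
move=> G0 S; have S0 (x : induced S) : False.
  by have := max_card (pred1 (val x)); rewrite card1 G0.
have col0 : colorable (induced S) 0.
  apply/existsP; exists [ffun x => match S0 x with end].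
  by apply/forallP => x; case: (S0 x).
rewrite /clique_number big1 => [|K _]; last by apply: eq_card0 => x; case: (S0 x).
rewrite /chromatic_number; case: ex_minnP => k _ /(_ 0 col0).
by rewrite leqn0 => /eqP.
Qed.

(** The least number of labels exists by excluded middle. *)
Lemma cw_constructible_at_most (G : sgraph) k :
  cw_constructible G k -> clique_width_at_most G k.
Proof.
elim/ltn_ind: k => k IH Gk.
have [[j [ltjk /IH Gj]]|min] := classic (exists j, j < k /\ cw_constructible G j).
  by have [w Gw lewj] := Gj ltjk; exists w => //; apply: leq_trans lewj (ltnW ltjk).
exists k => //; split=> // j Gj; rewrite leqNgt; apply/negP => ltjk.
by apply: min; exists j.
Qed.

Theorem theorem1p2 :
  exists k : nat, forall G : sgraph,
    free (fun H : sgraph => [\/ H = claw, H = four_K1, H = bridge | H = C4_twin]) G ->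
    perfect G \/ clique_width_at_most G k.
Proof.
exists #|{: option (blob_label palette * bool)}| => G freeG.
have [G0|Gpos] := posnP #|G|; first by left; apply: perfect_card0.
right; apply: cw_constructible_at_most.
have noK3K1 := coadj_K3_K1_free freeG (Or41 _ _ _ erefl).
have noK4 := coadj_K4_free freeG (Or42 _ _ _ erefl).
have noC42K1 := coadj_C4_2K1_free freeG (Or43 _ _ _ erefl).
have noP3K2 := coadj_P3_K2_free freeG (Or44 _ _ _ erefl).
have [col colP] := coloring_exists (@coadjC G) (@coadj_irr G) noK4 noK3K1 noP3K2.
have [c [f [e [eE cI hE]]]] :=
  blob_decomposition (@coadjC G) (@coadj_irr G) noK3K1 noP3K2 noC42K1 colP.
apply: (@cw_constructible_blobs G _ c (fun l m => ~~ f l m) e) => // x y nexy.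
rewrite -hE // /coadj; have -> : x != y; last by rewrite negbK.
by apply: contraNneq nexy => ->; have [] := eE y y y.
Qed.
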